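(* Let $A$ be a ring, $x,a\in A$, and $e\ge 0$. If $x^e(1-ax)=0$, then the triple $(A,x,x)$ is $1$-Jacobson. In particular, every $0$-dimensional ring $A$ is $1$-Jacobson.
   Context: All rings are commutative with identity (the trivial ring is allowed). A ring $A$ is $0$-dimensional (Krull dimension at most $0$) if for every $x\in A$ there exist $a\in A$ and $e\ge 0$ with $x^e(1-ax)=0$. For a subset $U$ of a ring $A$, $\langle U\rangle$ denotes the ideal generated by $U$. $\mathrm{Nil}_A 0:=\{x\in A:\exists n\ge 0,\ x^n=0\}$ is the nilradical. The image of an element in a quotient ring is denoted by the same letter. For a ring $A$, elements $x,x'\in A$ and an ordinal $\alpha$, the property ''the triple $(A,x,x')$ is $\alpha$-Jacobson'' is defined by recursion on $\alpha$: (1) $(A,x,x')$ is $0$-Jacobson if $x'\in\mathrm{Nil}_A 0$. (2) For $\alpha>0$, $(A,x,x')$ is $\alpha$-Jacobson if there exist $n\ge 0$ and $a_1,\ldots,a_n\in A$ such that for any $b_1,\ldots,b_n\in A$ there exists an ordinal $\beta<\alpha$ such that $(A/\langle 1-b_i(1-a_ix): i\in\{1,\ldots,n\}\rangle,\,x,\,x')$ is $\beta$-Jacobson. A ring $A$ is called $\alpha$-Jacobson if $(A,x,x)$ is $\alpha$-Jacobson for all $x\in A$. *)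

(* Defs.v *)
From HB Require Import structures.
From mathcomp Require Import all_boot all_order all_algebra generic_quotient.
From mathcomp Require Import ring_quotient.
From mathcomp Require Import boolp classical_sets.

Set Implicit Arguments.
Unset Strict Implicit.
Unset Printing Implicit Defensive.

Import Order.TTheory GRing.Theory.

Local Open Scope classical_set_scope.
Local Open Scope ring_scope.
Local Open Scope quotient_scope.

(** * Ordinals *)

(* [OSup f] represents the least ordinal strictly above all the [f i]; every
   ordinal has many representations, and [Ord] below is the quotient of [otree]
   by mutual comparison. *)
Inductive otree : Type := OSup (X : Type) of X -> otree.

Fixpoint otree_le (s t : otree) {struct s} : Prop :=
  let: OSup X f := s in let: OSup Y g := t in
  forall x : X, exists y : Y, otree_le (f x) (g y).

Definition otree_lt (s t : otree) : Prop :=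
  let: OSup Y g := t in exists y : Y, otree_le s (g y).

Lemma otree_le_refl s : otree_le s s.
Proof. by elim: s => X f IH /= x; exists x. Qed.

Lemma otree_le_trans t s u : otree_le s t -> otree_le t u -> otree_le s u.
Proof.
elim: s t u => X f IH [Y g] [Z h] /= st tu x.
have [y fg] := st x; have [z gh] := tu y; exists z; exact: IH fg gh.
Qed.

Lemma otree_ltW s t : otree_lt s t -> otree_le s t.
Proof.
elim: s t => X f IH [Y g] /= [y sy] x; exists y.
by apply: IH; case: (g y) sy => Z h /(_ x).
Qed.

Lemma otree_leNgt s t : ~ otree_le s t <-> otree_lt t s.
Proof.
elim: s t => X f IH [Y g] /=; split=> [/existsNP[x /forallNP fx]|[x gfx] fg].
  exists x; case: (f x) (IH x) fx => Z h IHx fx.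
  by move=> y; apply/(IHx (g y)).1/fx.
have [y fgy] := fg x.
by apply: (IH x (g y)).2 fgy; case: (f x) gfx => Z h; apply.
Qed.

Lemma otree_le_total s t : otree_le s t \/ otree_le t s.
Proof.
have [|/otree_leNgt/otree_ltW] := pselect (otree_le s t); first by left.
by right.
Qed.

Lemma otree_lt_le_trans s t u : otree_lt s t -> otree_le t u -> otree_lt s u.
Proof.
case: t u => [Y g] [Z h] /= [y sg] /(_ y)[z gh].
by exists z; apply: otree_le_trans gh.
Qed.

Lemma otree_lt_wf : well_founded otree_lt.
Proof.
suff acc t s : otree_le s t -> Acc otree_lt s.
  by move=> t; apply: acc (otree_le_refl t).
elim: t s => Y g IH s st; constructor=> u us.
by have [y /IH] := otree_lt_le_trans us st.
Qed.

Definition otree_eqv (s t : {classic otree}) : bool :=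
  `[< otree_le s t /\ otree_le t s >].

Lemma otree_eqv_is_equiv : equiv_class_of otree_eqv.
Proof.
split=> [s|s t|t s u].
- by apply/asboolP; split; apply: otree_le_refl.
- by apply/asboolP/asboolP => -[].
- move=> /asboolP[st ts] /asboolP[tu ut]; apply/asboolP.
  by split; [apply: otree_le_trans st tu|apply: otree_le_trans ut ts].
Qed.

Canonical otree_eqv_equiv := EquivRelPack otree_eqv_is_equiv.
Canonical otree_eqv_encModRel := defaultEncModRel otree_eqv.

Definition Ord : Type := {eq_quot otree_eqv}.
HB.instance Definition _ := Choice.on Ord.
HB.instance Definition _ : EqQuotient _ otree_eqv Ord := EqQuotient.on Ord.

Definition Ord_le (a b : Ord) : bool := `[< otree_le (repr a) (repr b) >].

Lemma Ord_le_refl : reflexive Ord_le.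
Proof. by move=> a; apply/asboolP; apply: otree_le_refl. Qed.

Lemma Ord_le_anti : antisymmetric Ord_le.
Proof.
move=> a b /andP[/asboolP ab /asboolP ba]; rewrite -[a]reprK -[b]reprK.
by apply/eqmodP/asboolP.
Qed.

Lemma Ord_le_trans : transitive Ord_le.
Proof.
by move=> b a c /asboolP ab /asboolP bc; apply/asboolP/(otree_le_trans ab bc).
Qed.

Lemma Ord_le_total : total Ord_le.
Proof.
move=> a b; apply/orP.
by case: (otree_le_total (repr a) (repr b)) => ?; [left|right]; apply/asboolP.
Qed.

Fact Ord_display : Order.disp_t. Proof. exact: Order.Disp tt tt. Qed.

HB.instance Definition _ := Order.Le_isPOrder.Build Ord_display Ord
  Ord_le_refl Ord_le_anti Ord_le_trans.
HB.instance Definition _ :=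
  Order.POrder_isTotal.Build Ord_display Ord Ord_le_total.

Lemma Ord_leE (s t : {classic otree}) :
  (\pi_Ord s <= \pi_Ord t)%O = `[< otree_le s t >].
Proof.
have pi_eqv u : otree_le u (repr (\pi_Ord u)) /\ otree_le (repr (\pi_Ord u)) u.
  suff /eqmodP/asboolP : u = repr (\pi_Ord u) %[mod Ord] by [].
  by rewrite reprK.
have [s1 s2] := pi_eqv s; have [t1 t2] := pi_eqv t.
apply/asboolP/asboolP => st.
  exact: otree_le_trans s1 (otree_le_trans st t2).
exact: otree_le_trans s2 (otree_le_trans st t1).
Qed.

Lemma Ord_ltE (s t : {classic otree}) :
  (\pi_Ord s < \pi_Ord t)%O = `[< otree_lt s t >].
Proof.
rewrite ltNge Ord_leE -asbool_neg.
by apply/asbool_equiv_eq; exact: otree_leNgt.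
Qed.

Lemma Ord_lt_wf : well_founded (fun a b : Ord => (a < b)%O).
Proof.
move=> a; rewrite -[a]reprK; elim/(well_founded_ind otree_lt_wf): (repr a).
move=> t IH; constructor=> b; rewrite -[b]reprK Ord_ltE => /asboolP.
exact: IH.
Qed.

(* The least ordinal strictly above all the [f x]. *)
Definition Ord_ssup (X : Type) (f : X -> Ord) : Ord :=
  \pi_Ord (OSup (fun x => repr (f x)) : {classic otree}).

Lemma Ord_ssup_leP (X : Type) (f : X -> Ord) (b : Ord) :
  (Ord_ssup f <= b)%O <-> forall x, (f x < b)%O.
Proof.
rewrite -[b]reprK Ord_leE; case: (repr b) => Y g; split.
  move=> /asboolP /= fg x; rewrite -[f x]reprK Ord_ltE; exact/asboolP/fg.
move=> fg; apply/asboolP => x /=.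
by have := fg x; rewrite -{1}[f x]reprK Ord_ltE => /asboolP.
Qed.

Definition Ord_zero : Ord := Ord_ssup (fun x : void => match x with end).
Definition Ord_succ (a : Ord) : Ord := Ord_ssup (fun _ : unit => a).
Definition Ord_one : Ord := Ord_succ Ord_zero.

Lemma Ord_le0x (a : Ord) : (Ord_zero <= a)%O.
Proof. by apply/Ord_ssup_leP; case. Qed.

HB.instance Definition _ :=
  Order.hasBottom.Build Ord_display Ord Ord_le0x.

Lemma Ord_succ_le (a b : Ord) : (Ord_succ a <= b)%O = (a < b)%O.
Proof.
by apply/idP/idP => [/Ord_ssup_leP/(_ tt)|ab]; last exact/Ord_ssup_leP.
Qed.

Lemma Ord_lt_one (a : Ord) : (a < Ord_one)%O = (a == Ord_zero).
Proof.
by rewrite ltNge Ord_succ_le -leNgt; apply/idP/eqP => [a0|->//];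
  apply/le_anti; rewrite a0 Ord_le0x.
Qed.

(** * Quotient by the ideal generated by a subset *)

Section IdealQuotient.
Variable A : comPzRingType.
Implicit Types (I U : set A).

(* The unit ideal is allowed, contrary to the library's [idealr_closed]. *)
Definition is_ideal I : Prop :=
  [/\ I 0, forall x y, I x -> I y -> I (x + y) & forall a x, I x -> I (a * x)].

Definition ideal_gen U : {pred A} := fun x => `[< smallest is_ideal U x >].

Lemma ideal_genP U x : reflect (smallest is_ideal U x) (x \in ideal_gen U).
Proof. exact: asboolP. Qed.

Lemma mem_ideal_gen U x : U x -> x \in ideal_gen U.
Proof. by move=> Ux; apply/ideal_genP; exact: (sub_gen_smallest Ux). Qed.

Lemma ideal_gen0 U : 0 \in ideal_gen U.
Proof. by apply/ideal_genP => I /= [[I0 _ _] _]. Qed.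

Lemma ideal_genD U : {in ideal_gen U &, forall x y, x + y \in ideal_gen U}.
Proof.
move=> x y /ideal_genP Ix /ideal_genP Iy; apply/ideal_genP => I /= UI.
by case: (UI) => -[_ ID _] _; apply: ID; [apply: Ix|apply: Iy].
Qed.

Lemma ideal_genM U a x : x \in ideal_gen U -> a * x \in ideal_gen U.
Proof.
move=> /ideal_genP Ix; apply/ideal_genP => I /= UI.
by case: (UI) => -[_ _ IM] _; apply: IM; apply: Ix.
Qed.

Lemma ideal_gen_zmod_closed U : zmod_closed (ideal_gen U).
Proof.
split=> [|x y Ux Uy]; first exact: ideal_gen0.
by rewrite ideal_genD// -mulN1r ideal_genM.
Qed.

HB.instance Definition _ U :=
  GRing.isZmodClosed.Build A (ideal_gen U) (ideal_gen_zmod_closed U).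

(* The library makes the additive quotient [{ideal_quot I}] a ring only for a
   nontrivial ring and a proper ideal, while here both the ring and its quotient
   may be trivial. *)
Definition quot_gen U : Type := {ideal_quot (ideal_gen U)}.
HB.instance Definition _ U := GRing.Zmodule.on (quot_gen U).

Definition quot_gen_pi U (x : A) : quot_gen U :=
  \pi_{ideal_quot (ideal_gen U)} x.

Lemma quot_gen_piP U x y :
  quot_gen_pi U x = quot_gen_pi U y <-> x - y \in ideal_gen U.
Proof. by rewrite Quotient.idealrBE; split=> /eqP. Qed.

Lemma quot_gen_pi_surj U (q : quot_gen U) : exists x, q = quot_gen_pi U x.
Proof.
exists (repr (q : {ideal_quot (ideal_gen U)})).
by rewrite /quot_gen_pi reprK.
Qed.

Lemma quot_gen_pi_is_zmod_morphism U : zmod_morphism (quot_gen_pi U).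
Proof. exact: (@pi_is_zmod_morphism _ _ _ {ideal_quot (ideal_gen U)}). Qed.

HB.instance Definition _ U := GRing.isZmodMorphism.Build A (quot_gen U)
  (quot_gen_pi U) (quot_gen_pi_is_zmod_morphism U).

Definition quot_gen_one U : quot_gen U := quot_gen_pi U 1.
Definition quot_gen_mul U (p q : quot_gen U) : quot_gen U :=
  quot_gen_pi U (repr (p : {ideal_quot (ideal_gen U)})
                 * repr (q : {ideal_quot (ideal_gen U)})).

Lemma quot_gen_piM U :
  {morph quot_gen_pi U : x y / x * y >-> quot_gen_mul x y}.
Proof.
have pi_repr x : x - repr (\pi_{ideal_quot (ideal_gen U)} x) \in ideal_gen U.
  by apply/quot_gen_piP; rewrite /quot_gen_pi reprK.
move=> x y; apply/quot_gen_piP; set x' := repr _; set y' := repr _.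
have -> : x * y - x' * y' = y * (x - x') + x' * (y - y').
  by rewrite !mulrBr addrA ![y * _]mulrC subrK.
by apply: ideal_genD; apply: ideal_genM; apply: pi_repr.
Qed.

Lemma quot_gen_mulA U : associative (@quot_gen_mul U).
Proof.
move=> p q r; have [x ->] := quot_gen_pi_surj p.
have [y ->] := quot_gen_pi_surj q; have [z ->] := quot_gen_pi_surj r.
by rewrite -!quot_gen_piM mulrA.
Qed.

Lemma quot_gen_mulC U : commutative (@quot_gen_mul U).
Proof. by move=> p q; rewrite /quot_gen_mul mulrC. Qed.

Lemma quot_gen_mul1 U : left_id (quot_gen_one U) (@quot_gen_mul U).
Proof.
move=> p; have [x ->] := quot_gen_pi_surj p.
by rewrite -quot_gen_piM mul1r.
Qed.

Lemma quot_gen_mulDl U : left_distributive (@quot_gen_mul U) +%R.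
Proof.
move=> p q r; have [x ->] := quot_gen_pi_surj p.
have [y ->] := quot_gen_pi_surj q; have [z ->] := quot_gen_pi_surj r.
by rewrite -raddfD -!quot_gen_piM mulrDl raddfD.
Qed.

HB.instance Definition _ U := GRing.Zmodule_isComPzRing.Build (quot_gen U)
  (@quot_gen_mulA U) (@quot_gen_mulC U) (@quot_gen_mul1 U) (@quot_gen_mulDl U).

Lemma quot_gen_pi_is_monoid_morphism U : monoid_morphism (quot_gen_pi U).
Proof. by split; last exact: quot_gen_piM. Qed.

HB.instance Definition _ U := GRing.isMonoidMorphism.Build A (quot_gen U)
  (quot_gen_pi U) (quot_gen_pi_is_monoid_morphism U).

End IdealQuotient.

(** * Jacobson triples and rings *)

Definition nilradical (A : comPzRingType) : set A :=
  [set x | exists n : nat, x ^+ n = 0].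

Definition zero_dimensional (A : comPzRingType) : Prop :=
  forall x : A, exists (a : A) (e : nat), x ^+ e * (1 - a * x) = 0.

(* The generators of the ideal by which the recursion passes to the quotient. *)
Definition jacobson_gens (A : comPzRingType) (x : A) (n : nat)
    (a b : 'I_n -> A) : set A :=
  [set 1 - b i * (1 - a i * x) | i in [set: 'I_n]].

(* The recursion on the ordinal [alpha] is rendered by an inductive predicate:
   by [jacobson_triple_zero] and [jacobson_triple_gt0] it satisfies the two
   defining clauses, and these determine it because the order of [Ord] is
   well-founded. *)
Inductive jacobson_triple (alpha : Ord) (A : comPzRingType) (x x' : A) : Prop :=
| Jacobson_zero of alpha = Ord_zero & nilradical x'
| Jacobson_gt0 of (Ord_zero < alpha)%O &
    exists (n : nat) (a : 'I_n -> A), forall b : 'I_n -> A,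
    exists2 beta : Ord, (beta < alpha)%O &
      let U := jacobson_gens x a b in
      @jacobson_triple beta (quot_gen U) (quot_gen_pi U x) (quot_gen_pi U x').

Lemma jacobson_triple_zero (A : comPzRingType) (x x' : A) :
  jacobson_triple Ord_zero x x' <-> nilradical x'.
Proof. by split=> [[//|]|?]; [rewrite ltxx|exact: Jacobson_zero]. Qed.

Lemma jacobson_triple_gt0 (alpha : Ord) (A : comPzRingType) (x x' : A) :
  (Ord_zero < alpha)%O ->
  jacobson_triple alpha x x' <->
  exists (n : nat) (a : 'I_n -> A), forall b : 'I_n -> A,
  exists2 beta : Ord, (beta < alpha)%O &
    let U := jacobson_gens x a b in
    jacobson_triple beta (quot_gen_pi U x) (quot_gen_pi U x').
Proof.
move=> alpha0; split=> [[alphaE|//]|?]; last exact: Jacobson_gt0.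
by move: alpha0; rewrite alphaE ltxx.
Qed.

Definition jacobson_ring (alpha : Ord) (A : comPzRingType) : Prop :=
  forall x : A, jacobson_triple alpha x x.

(* Main.v *)
Require Import Defs.
From mathcomp Require Import all_boot all_order all_algebra.

Import GRing.Theory.
Local Open Scope ring_scope.

(** The given [a] serves as the single coefficient. As [x ^+ e] annihilates [1 - a * x], multiplying
    the generator [1 - b * (1 - a * x)] by [x ^+ e] returns [x ^+ e]. So [x ^+ e] lies in the ideal
    and [x] is nilpotent in the quotient. *)

Theorem proposition6 (A : comPzRingType) :
  (forall (x a : A) (e : nat),
     x ^+ e * (1 - a * x) = 0 -> jacobson_triple Ord_one x x)
  /\ (zero_dimensional A -> jacobson_ring Ord_one A).
Proof.
have jacobson1 (x a : A) (e : nat) :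
    x ^+ e * (1 - a * x) = 0 -> jacobson_triple Ord_one x x.
  move=> xe0; have lt01 : (Ord_zero < Ord_one)%O by rewrite Ord_lt_one.
  apply/jacobson_triple_gt0 => //; exists 1%N, (fun=> a) => b.
  (* [Ord_zero] is the only ordinal below [Ord_one]; the exponent [e] works for every [b]. *)
  exists Ord_zero => //=; apply/jacobson_triple_zero; exists e.
  set U := jacobson_gens _ _ _.
  rewrite -rmorphXn -(rmorph0 (quot_gen_pi U)); apply/quot_gen_piP.
  have -> : x ^+ e - 0 = x ^+ e * (1 - b ord0 * (1 - a * x)).
    by rewrite mulrBr mulr1 mulrCA xe0 mulr0.
  by apply/ideal_genM/mem_ideal_gen; exists ord0.
split=> // dim0 x; have [a [e xe0]] := dim0 x.
exact: jacobson1 xe0.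
Qed.
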